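(* Let $d\ge 4$ and let $V$ be a $2d$-dimensional vector space over $\mathbb{F}_2$ equipped with a quadratic form $\theta:V\to\mathbb{F}_2$ that polarizes to a symplectic form $\varphi$. Let $V=U\perp W$ be an orthogonal decomposition (with respect to $\varphi$) into non-degenerate subspaces $U,W$ of even dimensions $\dim U,\dim W\ge 4$. Let $$B:=U^1+W^1=\{u+w \mid u\in U,\ w\in W,\ \theta(u)=\theta(w)=1\}$$ and, for some fixed $c\in V^1$, $$C:=V^0\cap c^\perp=\{v\in V \mid \theta(v)=0,\ \varphi(v,c)=0,\ v\neq 0\}.$$ Then the following holds. (i) $2^{d-1}$ divides $|B\cap C^g|$ for all $g\in \mathrm{O}(V,\theta)$, but (ii) $2^{d-1}$ is no divisor of $|B|\,|C|$. Thus $B,C$ are contradicting subsets (modulo $2^{d-1}$) for the action of $\mathrm{O}(V,\theta)$ on the set $V^0$ of singular vectors. Therefore, the orthogonal groups $\mathrm{O}^{\pm}(2d,2)$, $d\ge 4$, contain no sets that are sharply transitive on the singular vectors; that is, for every $d\geq 4$ and every such $(V,\theta)$ (of either Witt index), $\mathrm{O}(V,\theta)$ contains no subset that is sharply transitive on $V^0$.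
   Context: A symplectic form is an alternating, bilinear, non-degenerate form. A quadratic form $\theta:V\to\mathbb{F}_2$ polarizes to $\varphi$ if $\theta(u+v)=\theta(u)+\theta(v)+\varphi(u,v)$ for all $u,v\in V$. For $c\in V$, $c^\perp=\{v\in V\mid \varphi(v,c)=0\}$. For a subset $X\subseteq V$ put $X^0:=\{v\in X\mid \theta(v)=0,\ v\ne 0\}$ and $X^1:=\{v\in X\mid\theta(v)=1\}$. A subspace is non-degenerate if the restriction of $\varphi$ to it is non-degenerate. $\mathrm{O}(V,\theta)$ is the group of linear automorphisms of $V$ preserving $\theta$, acting on vectors by $v\mapsto v^g$; for $C\subseteq V$, $C^g=\{v^g\mid v\in C\}$. The groups $\mathrm{O}^{+}(2d,2)$ and $\mathrm{O}^{-}(2d,2)$ are the groups $\mathrm{O}(V,\theta)$ where $\theta$ has Witt index $d$, respectively $d-1$. The singular vectors are the elements of $V^0$. A set $S$ of permutations of a finite set $\Omega$ is sharply transitive on $\Omega$ if for all $\alpha,\beta\in\Omega$ there is a unique $g\in S$ with $\alpha^g=\beta$. For a permutation group $G$ on a finite set $\Omega$, subsets $B,C\subseteq\Omega$ are called contradicting subsets for $G$ (modulo $k$), $k$ a natural number, if $k$ divides $|B\cap C^g|$ for all $g\in G$ but $k$ does not divide $|B|\,|C|$. *)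

(* Defs.v *)
(* MathComp *)
From HB Require Import structures.
From mathcomp Require Import all_boot all_order all_algebra all_fingroup all_field.

Set Implicit Arguments.
Unset Strict Implicit.
Unset Printing Implicit Defensive.

Import GRing.Theory.
Local Open Scope ring_scope.

Section PermutationSets.
Variable T : finType.
Implicit Types (S : {set {perm T}}) (G : {group {perm T}}).
Implicit Types (Omega B C : {set T}) (k : nat).

(* A permutation of Omega is represented by a permutation of the ambient type T
   that stabilizes Omega, hence the [acts _, on Omega | 'P] conditions. *)
Definition sharply_transitive S Omega : Prop :=
  [acts S, on Omega | 'P] /\
  forall a b : T, a \in Omega -> b \in Omega ->
    exists! g : {perm T}, g \in S /\ g a = b.

Definition contradicting_subsets G Omega k B C : Prop :=
  [/\ [acts G, on Omega | 'P],
      B \subset Omega,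
      C \subset Omega,
      forall g : {perm T}, g \in G -> (k %| #|B :&: [set g v | v in C]|)%N
    & ~~ (k %| #|B| * #|C|)%N].

End PermutationSets.

Section QuadraticForms.
Variables (F : fieldType) (V : vectType F).
Implicit Types (q : V -> F) (b : V -> V -> F).

Definition polarizes_to q b : Prop :=
  forall u v, q (u + v) = q u + q v + b u v.

Definition quadratic_form q : Prop :=
  (forall a v, q (a *: v) = a ^+ 2 * q v) /\
  exists b : {biscalar V}, polarizes_to q b.

Definition nondegenerate_on b (U : {vspace V}) : Prop :=
  forall u, u \in U -> {in U, forall v, b u v = 0} -> u = 0.

Definition orthogonal_decomposition (phi : {skew_symmetric V})
    (U W : {vspace V}) : Prop :=
  [/\ (U + W = fullv)%VS, (U :&: W = 0)%VS & (U <= orthov phi W)%VS].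

End QuadraticForms.

(* finvect_type V is V itself, equipped with its finite type structure; it is
   what allows {set _} and {perm _} to be formed. *)
Section OrthogonalGroup.
Variables (F : finFieldType) (V : vectType F).
Local Notation fV := (finvect_type V).
Variable theta : V -> F.

Definition singular (X : {pred V}) : {set fV} :=
  [set v : fV | [&& v \in X, theta v == 0 & v != 0]].

Definition value_one (X : {pred V}) : {set fV} :=
  [set v : fV | (v \in X) && (theta v == 1)].

Definition orthogonal_set : {set {perm fV}} :=
  [set g : {perm fV} |
    [forall a : F, [forall u : fV, [forall v : fV,
       g (a *: u + v) == a *: g u + g v]]]
    && [forall v : fV, theta (g v) == theta v]].

Lemma orthogonal_setP (g : {perm fV}) :
  reflect (linear (g : fV -> fV) /\ forall v : fV, theta (g v) = theta v)
          (g \in orthogonal_set).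
Proof.
rewrite inE; apply: (iffP andP) => [[/forallP lin /forallP iso]|[lin iso]].
  split=> [a u v|v]; last exact/eqP.
  by have /forallP/(_ u)/forallP/(_ v)/eqP := lin a.
split; last by apply/forallP=> v; rewrite iso.
by do 3![apply/forallP=> ?]; rewrite lin.
Qed.

Lemma orthogonal_group_set : group_set orthogonal_set.
Proof.
apply/group_setP; split.
  by apply/orthogonal_setP; split=> [a u v|v]; rewrite !perm1.
move=> g h /orthogonal_setP[ling isog] /orthogonal_setP[linh isoh].
apply/orthogonal_setP; split=> [a u v|v]; rewrite !permM.
  by rewrite ling linh.
by rewrite isoh isog.
Qed.

Definition orthogonal_group : {group {perm fV}} := Group orthogonal_group_set.

End OrthogonalGroup.

(* Main.v *)
Require Import Defs.
From HB Require Import structures.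
From mathcomp Require Import all_boot all_order all_algebra all_fingroup all_field.
From mathcomp Require Import ring zify.

Set Implicit Arguments.
Unset Strict Implicit.
Unset Printing Implicit Defensive.

Import GRing.Theory.
Local Open Scope ring_scope.

(** The divisibility statements are counts with quadratic Gauss sums.  Over a
    non-degenerate subspace U of dimension 2m, the sum S of (-1)^(theta u)
    satisfies S^2 = 2^(2m), hence S = 2s 2^(m-1) for a sign s
    ([gauss_sum_sqr]).  Expanding indicator functions into characters, the
    number of u in U with theta u = j and phi u a = i, for a in U, becomes

      2^(m-1) (2^(m-1) (1 + (-1)^i [a = 0]) + (-1)^j s [i = theta a])

    ([card_level_set_even]), and everything is read off from this formula.
    Taking a = 0 shows that U^1 has 2^(m-1) times an odd number of elements,
    so B = U^1 + W^1 has 2^(d-2) times an odd number.  Taking U = V and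
    a = c with theta c = 1 shows that C together with 0 has 2^(2d-2) elements,
    so |C| is odd.  Hence 2^(d-1) does not divide |B||C|.

    For g orthogonal, B meets C^g in the vectors of B orthogonal to c^g
    ([perp_image]), and theta (c^g) = 1.  Write c^g = a + b with a in U, b in W.  The
    vectors u + w of B orthogonal to c^g are those with phi u a = phi w b, so
    their number is the sum over i of products of two of the counts above.
    Because theta a + theta b = 1, each i differs from theta a or from theta b;
    in the corresponding factor the term with s vanishes, and that factor gains
    a second power of 2.  The hypothesis that U and W have dimension at least 4
    makes this gain large enough ([dvdn_card_value_one_sum_perp]).

    Contradicting subsets B, C exclude a sharply transitive subset S, because
    the sum of |B :&: C^g| over g in S counts each pair of B x C exactly once
    ([contradicting_not_sharply_transitive]).  For d >= 4 such B and C exist: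
    splitting off two hyperbolic planes from V gives a decomposition with
    \dim U = 4 and \dim W = 2d - 4 ([exists_orthogonal_decomposition]). *)

(** * Contradicting subsets exclude sharply transitive sets *)

(** Double counting of the triples (g, b, c) with g in S and b = g c: each pair
    (b, c) occurs for a single g, so the sum of |B :&: C^g| over g in S is
    |B||C|, while k divides each of its terms. *)
Lemma contradicting_not_sharply_transitive (T : finType) (G : {group {perm T}})
    (Omega : {set T}) k (B C : {set T}) (S : {set {perm T}}) :
  contradicting_subsets G Omega k B C -> S \subset G ->
  ~ sharply_transitive S Omega.
Proof.
move=> [_ /subsetP BO /subsetP CO dvdBC ndvd] /subsetP SG [_ sharp].
case/negP: ndvd.
suff <- : (\sum_(g in S) #|B :&: [set g v | v in C]| = #|B| * #|C|)%N.
  by apply: dvdn_sum => g /SG/dvdBC.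
have cardBC (g : {perm T}) :
    (#|B :&: [set g v | v in C]| = \sum_(b in B) \sum_(c in C) (g c == b))%N.
  rewrite -sum1_card (eq_bigl _ _ (fun b => in_setI b B _)) big_mkcondr /=.
  apply: eq_bigr => b _; case: imsetP => [[c cC ->]|notin].
    rewrite (bigD1 c) //= eqxx big1 // => c' /andP[_ /negPf c'c].
    by rewrite (inj_eq perm_inj) c'c.
  rewrite big1 // => c cC; apply/eqP; rewrite eqb0.
  by apply/eqP => gcb; apply: notin; exists c.
under eq_bigr => g _ do rewrite cardBC.
rewrite exchange_big /= -sum_nat_const; apply: eq_bigr => b bB.
rewrite exchange_big /= -sum1_card; apply: eq_bigr => c cC.
have [g [[gS gc] uniq_g]] := sharp c b (CO c cC) (BO b bB).
rewrite (bigD1 g) //= gc eqxx big1 // => h /andP[hS hg].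
by apply/eqP; rewrite eqb0; apply: contraNN hg => /eqP hc; rewrite (uniq_g h).
Qed.

(** * Characters of the field with two elements *)

Lemma F2_cases (x : 'F_2) : x = 0 \/ x = 1.
Proof.
case: x => [[|[|n]] ltn]; [left | right | by []]; exact: val_inj.
Qed.

Definition sign (x : 'F_2) : int := if x == 0 then 1 else -1.

Lemma sign0 : sign 0 = 1. Proof. by []. Qed.
Lemma sign1 : sign 1 = -1. Proof. by []. Qed.
Definition signE := (sign0, sign1).

Lemma signD x y : sign (x + y) = sign x * sign y.
Proof. by case: (F2_cases x) => ->; case: (F2_cases y) => ->. Qed.

Lemma sign_sqr x : sign x * sign x = 1.
Proof. by case: (F2_cases x) => ->. Qed.

Lemma indicator_sign (x y : 'F_2) : 2 * (x == y)%:Z = 1 + sign y * sign x.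
Proof. by case: (F2_cases x) => ->; case: (F2_cases y) => ->. Qed.

(** * Auxiliary facts on subspaces and divisibility *)

Lemma card_vspaceF2 (V : vectType 'F_2) (U : {vspace V}) :
  #|[pred u : finvect_type V | u \in U]| = (2 ^ \dim U)%N.
Proof.
(* Opening the structure of V lets its carrier take the finite type structure. *)
case: V U => T vT U; have := @card_vspace 'F_2 (finvect_type (Vector.Pack vT)) vT U.
by rewrite [X in (X ^ _)%N]card_Fp.
Qed.

Lemma exp2_int k : (2 ^ k)%N%:Z = 2 ^+ k.
Proof. by rewrite -natz natrX. Qed.

Lemma dvdn_int_factor (d n : nat) (k : int) : n%:Z = d%:Z * k -> (d %| n)%N.
Proof. by move=> n_dk; rewrite -[(d %| n)%N]/(d %| n%:Z)%Z n_dk dvdz_mulr. Qed.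

Lemma direct_sum_inj (F : fieldType) (V : vectType F) (U W : {vspace V})
    (u u' w w' : V) :
  (U :&: W = 0)%VS -> u \in U -> u' \in U -> w \in W -> w' \in W ->
  u + w = u' + w' -> u = u' /\ w = w'.
Proof.
move=> UW0 uU u'U wW w'W eq_sum.
have uu' : u - u' = w' - w.
  by apply/eqP; rewrite subr_eq addrAC eq_sym subr_eq [w' + _]addrC eq_sum.
have : u - u' \in (U :&: W)%VS by rewrite memv_cap memvB //= uu' memvB.
rewrite UW0 memv0 subr_eq0 => /eqP eq_u; split=> //.
by move: eq_sum; rewrite eq_u => /addrI.
Qed.

(** * Gauss sums of a quadratic form *)

Section QuadraticFormCounting.
Variables (V : vectType 'F_2) (theta : V -> 'F_2) (phi : {skew_symmetric V}).
Hypothesis polar : polarizes_to theta phi.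
Local Notation fV := (finvect_type V).

Definition gauss_sum (U : {vspace V}) : int :=
  \sum_(u : fV | u \in U) sign (theta u).

Definition value_one_sum (U W : {vspace V}) : {set fV} :=
  [set u + w | u in value_one theta U, w in value_one theta W].

Definition level_set (U : {vspace V}) (j : 'F_2) (a : V) (i : 'F_2) : {set fV} :=
  [set u : fV | [&& u \in U, theta u == j & phi u a == i]].

Arguments level_set U j%_R a i%_R.

(** The two additivity laws are restated so that the result is again an
    application of phi itself, on which [skewF2C] can act. *)
Lemma formDl (u v w : V) : phi (u + v) w = phi u w + phi v w.
Proof. exact: linearDl. Qed.

Lemma formDr (u v w : V) : phi u (v + w) = phi u v + phi u w.
Proof. exact: linearDr. Qed.

Lemma skewF2C (u v : V) : phi u v = phi v u.
Proof.
apply/eqP; have := herm_eq0C phi u v.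
by case: (F2_cases (phi u v)) => ->; case: (F2_cases (phi v u)) => ->.
Qed.

Lemma theta0 : theta 0 = 0.
Proof.
have := polar 0 0; rewrite addr0 linear0r addr0.
by case: (F2_cases (theta 0)) => ->.
Qed.

Lemma sum_translate (U : {vspace V}) (w : V) (f : V -> int) : w \in U ->
  \sum_(u : fV | u \in U) f (u + w) = \sum_(u : fV | u \in U) f u.
Proof.
move=> wU; rewrite [RHS](reindex_inj (addIr (w : fV))).
by apply: eq_bigl => u; exact/esym/(@rpredDr V).
Qed.

Lemma sum1_vspace (U : {vspace V}) :
  \sum_(u : fV | u \in U) 1 = 2 ^+ \dim U :> int.
Proof.
rewrite sumr_const -natrX; congr (_%:R).
exact: card_vspaceF2.
Qed.

(** Orthogonality of characters: if a is not 0 then some w in U has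
    phi w a = 1, and translation by w negates the sum. *)
Lemma sum_sign_form (U : {vspace V}) (a : V) :
  nondegenerate_on phi U -> a \in U ->
  \sum_(u : fV | u \in U) sign (phi u a) = (a == 0)%:Z * 2 ^+ \dim U.
Proof.
move=> ndU aU; have [->|a_neq0] := eqVneq a 0.
  rewrite (eq_bigr (fun=> 1)) => [|u _]; last by rewrite linear0r.
  by rewrite mul1r sum1_vspace.
have /mem_orthovPn[w wU aw] : a \notin orthov phi U.
  by apply: contraNN a_neq0 => /mem_orthovP/(ndU a aU)->.
have := sum_translate (fun u => sign (phi u a)) wU.
rewrite (eq_bigr (fun u : fV => - sign (phi u a))) => [|u _].
  by rewrite sumrN; set S := (\sum_(u : fV | _) _) => eqS; rewrite mul0r; lia.
rewrite formDl signD (skewF2C w).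
by case: (F2_cases (phi a w)) aw => ->; rewrite // signE mulrN1.
Qed.

(** Translating by a turns theta u into theta u + phi u a, up to the constant
    theta a; so twisting by the character phi _ a only changes the sign. *)
Lemma gauss_sum_twist (U : {vspace V}) (a : V) : a \in U ->
  \sum_(u : fV | u \in U) sign (theta u) * sign (phi u a)
    = sign (theta a) * gauss_sum U.
Proof.
move=> aU; rewrite /gauss_sum -(sum_translate (fun u => sign (theta u)) aU) mulr_sumr.
apply: eq_bigr => u _; rewrite polar !signD.
by rewrite -[LHS]mul1r -(sign_sqr (theta a)); ring.
Qed.

(** Each product of sign (theta t) with the Gauss sum is a twisted Gauss sum;
    after exchanging the summations the inner sum is a character sum, which is
    nonzero for t = 0 alone. *)
Lemma gauss_sum_sqr (U : {vspace V}) :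
  nondegenerate_on phi U -> gauss_sum U ^+ 2 = 2 ^+ \dim U.
Proof.
move=> ndU; transitivity (\sum_(t : fV | t \in U) sign (theta t) *
    \sum_(u : fV | u \in U) sign (phi u t)).
  rewrite expr2 {2}/gauss_sum mulr_sumr.
  under eq_bigr => t tU do rewrite mulrC -gauss_sum_twist //.
  rewrite exchange_big; apply: eq_bigr => u _; rewrite mulr_sumr.
  by apply: eq_bigr => t _; rewrite skewF2C.
rewrite (bigD1 ((0 : V) : fV)) /=; last exact: mem0v.
rewrite sum_sign_form ?mem0v // theta0 eqxx big1 ?addr0 ?mul1r //.
by move=> t /andP[tU /negPf t0]; rewrite sum_sign_form // t0 mul0r mulr0.
Qed.

Lemma gauss_sum_even (U : {vspace V}) m :
  nondegenerate_on phi U -> \dim U = (2 * m)%N ->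
  gauss_sum U = 2 ^+ m \/ gauss_sum U = - 2 ^+ m.
Proof.
move=> ndU dimU; have/eqP := gauss_sum_sqr ndU; rewrite dimU mulnC exprM eqf_sqr.
by case/orP => /eqP; [left | right].
Qed.

(** * Vectors with prescribed value and prescribed product *)

(** Expansion of the product of the two indicator functions into characters;
    the four resulting sums are |U|, the Gauss sum, the character sum and the
    twisted Gauss sum. *)
Lemma card_level_set (U : {vspace V}) j a i :
  nondegenerate_on phi U -> a \in U ->
  4 * #|level_set U j a i|%:Z =
    2 ^+ \dim U + sign j * gauss_sum U
    + sign i * ((a == 0)%:Z * 2 ^+ \dim U + sign j * sign (theta a) * gauss_sum U).
Proof.
move=> ndU aU.
rewrite -sum_sign_form // -mulrA -gauss_sum_twist // -sum1_vspace /gauss_sum.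
rewrite !mulrDr !mulr_sumr -!big_split /=.
rewrite -sum1_card (big_morph Posz PoszD (erefl _)) mulr_sumr.
rewrite [LHS](eq_bigl
  (fun u : fV => (u \in U) && ((theta u == j) && (phi u a == i)))); last first.
  by move=> u; rewrite inE.
rewrite big_mkcondr; apply: eq_bigr => u _ /=.
transitivity ((1 + sign j * sign (theta u)) * (1 + sign i * sign (phi u a))).
  by rewrite -!indicator_sign; case: eqP => _; case: eqP.
by ring.
Qed.

(** The closed formula from which all cardinalities are derived, written with
    half the dimension equal to m + 1.  The sign s is that of the Gauss sum: it
    tells which of the two types of quadratic form theta has on U. *)
Lemma card_level_set_even (U : {vspace V}) m :
  nondegenerate_on phi U -> \dim U = (2 * m.+1)%N ->
  exists2 s : int, s = 1 \/ s = -1 &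
    forall j a i, a \in U ->
      #|level_set U j a i|%:Z =
        (2 ^ m)%N%:Z * (2 ^+ m * (1 + sign i * (a == 0)%:Z)
                   + sign j * s * (i == theta a)%:Z).
Proof.
move=> ndU dimU.
have [s s_eq s_gauss] : exists2 s : int, s = 1 \/ s = -1 & gauss_sum U = s * 2 ^+ m.+1.
  by case: (gauss_sum_even ndU dimU) => ->;
     [exists 1; [left | rewrite mul1r] | exists (-1); [right | rewrite mulN1r]].
exists s => // j a i aU.
have := card_level_set j i ndU aU; have := indicator_sign (theta a) i.
rewrite s_gauss dimU mulnC exprM exprS exp2_int [2 ^+ m.+1]exprS eq_sym.
move: (2 ^+ m) => Q indE cardE.
apply: (@mulfI _ (4 : int)) => //; rewrite {}cardE.
transitivity (4 * Q ^+ 2 * (1 + sign i * (a == 0)%:Z)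
              + 2 * sign j * s * Q * (1 + sign i * sign (theta a))); first by ring.
by rewrite -indE; ring.
Qed.

(** At a = 0 and i = 0 the formula gives 2^m (2^(m+1) - s) with s odd. *)
Lemma card_value_one (U : {vspace V}) m :
  nondegenerate_on phi U -> \dim U = (2 * m.+1)%N ->
  exists2 q, odd q & #|value_one theta U| = (2 ^ m * q)%N.
Proof.
move=> ndU dimU; have [s s_eq cardU] := card_level_set_even ndU dimU.
have := cardU 1 0 0 (mem0v U).
have -> : level_set U 1 0 0 = value_one theta U.
  by apply/setP => u; rewrite !inE linear0r eqxx andbT.
rewrite theta0 !eqxx !signE !mulr1 -exp2_int.
case: s_eq => -> eqN; [exists (2 ^ m * 2).-1%N | exists (2 ^ m * 2).+1%N].
- by rewrite -subn1 oddB ?muln_gt0 ?expn_gt0 // oddM andbF.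
- have : (0 < 2 ^ m)%N by rewrite expn_gt0.
  by move=> ?; apply/eqP; rewrite -eqz_nat eqN PoszM; apply/eqP; congr (_ * _); lia.
- by rewrite /= oddM andbF.
- by apply/eqP; rewrite -eqz_nat eqN PoszM; apply/eqP; congr (_ * _); lia.
Qed.

Lemma dvdn_level_set1 (U : {vspace V}) m a i :
  nondegenerate_on phi U -> \dim U = (2 * m.+1)%N -> a \in U ->
  (2 ^ m %| #|level_set U 1 a i|)%N.
Proof.
move=> ndU dimU aU; have [s _ cardU] := card_level_set_even ndU dimU.
exact: dvdn_int_factor (cardU 1 a i aU).
Qed.

(** For i different from theta a the term with the sign s vanishes, and the
    remaining term contains the power 2^m twice. *)
Lemma dvdn_level_set1_neq (U : {vspace V}) m a i :
  nondegenerate_on phi U -> \dim U = (2 * m.+1)%N -> a \in U ->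
  i != theta a -> (2 ^ (m + m) %| #|level_set U 1 a i|)%N.
Proof.
move=> ndU dimU aU /negPf i_a; have [s _ cardU] := card_level_set_even ndU dimU.
apply: (@dvdn_int_factor _ _ (1 + sign i * (a == 0)%:Z)).
by rewrite cardU // i_a mulr0 addr0 expnD PoszM -mulrA -exp2_int.
Qed.

(** For theta c = 1 and i = 0 the sign s does not contribute, so the count is
    the same for both types of quadratic form.  The successor accounts for the
    vector 0, which is not singular. *)
Lemma card_singular_perp m (c : V) :
  nondegenerate_on phi fullv -> \dim {:V} = (2 * m.+1)%N -> theta c = 1 ->
  #|[set v in singular theta {:V} | phi v c == 0]|.+1 = (2 ^ (m + m))%N.
Proof.
move=> ndV dimV theta_c; have [s _ cardV] := card_level_set_even ndV dimV.
have c_neq0 : c != 0 by apply/eqP => c0; move: theta_c; rewrite c0 theta0.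
have := cardV 0 c 0 (memvf c).
rewrite theta_c (negPf c_neq0) !mulr0 !addr0 mulr1 -exp2_int -PoszM -expnD => -[<-].
have zero_in : ((0 : V) : fV) \in level_set fullv 0 c 0.
  by rewrite inE; apply/and3P; split; [exact: mem0v | rewrite theta0 | rewrite linear0l].
rewrite (cardsD1 ((0 : V) : fV) (level_set fullv 0 c 0)) zero_in add1n.
congr (_.+1); apply: eq_card => v; rewrite !inE memvf.
by case: (v == 0); rewrite ?andbF ?andbT.
Qed.

(** * The sum of U^1 and W^1 *)

(** Since the sum is direct, its elements are pairs (u, w), and u + w is
    orthogonal to c exactly if phi u c and phi w c have the same value i. *)
Lemma card_value_one_sum_perp (U W : {vspace V}) (c : V) : (U :&: W = 0)%VS ->
  #|[set v in value_one_sum U W | phi v c == 0]| =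
    (\sum_(i : 'F_2) #|level_set U 1 c i| * #|level_set W 1 c i|)%N.
Proof.
move=> UW0.
pose D := [set p : fV * fV | [&& p.1 \in value_one theta U,
             p.2 \in value_one theta W & phi p.1 c == phi p.2 c]].
have -> : [set v in value_one_sum U W | phi v c == 0] = [set p.1 + p.2 | p in D].
  apply/setP => v; rewrite inE; apply/andP/imsetP.
    case=> /imset2P[u w uU wW ->] perp; exists (u, w) => //.
    rewrite inE uU wW /=; move: perp; rewrite formDl.
    by case: (F2_cases (phi u c)) => ->; case: (F2_cases (phi w c)) => ->.
  case=> [[u w]]; rewrite inE => /and3P[uU wW /eqP /= eq_uw] ->; split.
    exact: imset2_f.
  by rewrite formDl eq_uw; case: (F2_cases (phi w c)) => ->.
rewrite card_in_imset => [|[u w] [u' w']]; last first.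
  rewrite !inE /= => /and3P[/andP[uU _] /andP[wW _] _].
  move=> /and3P[/andP[uU' _] /andP[wW' _] _] eq_sum.
  by have [-> ->] := direct_sum_inj UW0 uU uU' wW wW' eq_sum.
rewrite -sum1_card (partition_big (fun p : fV * fV => phi p.1 c) predT) //=.
apply: eq_bigr => i _; rewrite -cardsX -sum1_card; apply: eq_bigl => -[u w].
rewrite !inE /=; case: (u \in U); case: (w \in W); rewrite ?andbF //=.
case: (theta u == 1); case: (theta w == 1); rewrite ?andbF //=.
by case: (phi u c =P i) => [->|_]; rewrite ?andbF // andbT eq_sym.
Qed.

(** With c = a + b, products with c are products with a on U and with b on W.
    As theta a and theta b differ, every i differs from one of them, and the
    corresponding factor is divisible by the square of the usual power.  The
    half-dimensions are m + 2 and k + 2, so a summand is divisible by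
    2^(m+1) 2^(2k+2) or by 2^(2m+2) 2^(k+1). *)
Lemma dvdn_card_value_one_sum_perp (U W : {vspace V}) m k (c : V) :
  orthogonal_decomposition phi U W ->
  nondegenerate_on phi U -> nondegenerate_on phi W ->
  \dim U = (2 * m.+2)%N -> \dim W = (2 * k.+2)%N -> theta c = 1 ->
  (2 ^ (m + k + 3) %| #|[set v in value_one_sum U W | phi v c == 0%R]|)%N.
Proof.
move=> [UW_V UW0 UW_orth] ndU ndW dimU dimW theta_c; rewrite card_value_one_sum_perp //.
have [a aU [b bW c_ab]] : exists2 a, a \in U & exists2 b, b \in W & c = a + b.
  by apply/memv_addP; rewrite UW_V memvf.
have perp u w : u \in U -> w \in W -> phi u w = 0 by move/orthovP: UW_orth; apply.
have theta_ab : theta a + theta b = 1 by rewrite -theta_c c_ab polar perp ?addr0.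
apply: dvdn_sum => i _.
have -> : level_set U 1 c i = level_set U 1 a i.
  apply/setP => u; rewrite !inE; case uU: (u \in U) => //=.
  by rewrite c_ab formDr (perp u b) ?addr0.
have -> : level_set W 1 c i = level_set W 1 b i.
  apply/setP => w; rewrite !inE; case wW: (w \in W) => //=.
  by rewrite c_ab formDr (skewF2C w a) (perp a w) ?add0r.
have [i_a|i_a] := eqVneq i (theta a).
  apply: dvdn_trans (dvdn_mul (dvdn_level_set1 i ndU dimU aU)
                              (dvdn_level_set1_neq ndW dimW bW _)).
    by rewrite -expnD dvdn_exp2l //; lia.
  rewrite i_a; move: theta_ab.
  by case: (F2_cases (theta a)) => ->; case: (F2_cases (theta b)) => ->.
apply: dvdn_trans (dvdn_mul (dvdn_level_set1_neq ndU dimU aU i_a)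
                            (dvdn_level_set1 i ndW dimW bW)).
by rewrite -expnD dvdn_exp2l //; lia.
Qed.

Lemma card_value_one_sum (U W : {vspace V}) : (U :&: W = 0)%VS ->
  #|value_one_sum U W| = (#|value_one theta U| * #|value_one theta W|)%N.
Proof.
move=> UW0; rewrite /value_one_sum curry_imset2X card_in_imset ?cardsX //.
move=> [u w] [u' w']; rewrite !inE /= => /andP[/andP[uU _] /andP[wW _]].
move=> /andP[/andP[uU' _] /andP[wW' _]] eq_sum.
by have [-> ->] := direct_sum_inj UW0 uU uU' wW wW' eq_sum.
Qed.

Lemma value_one_sum_singular (U W : {vspace V}) :
  orthogonal_decomposition phi U W -> value_one_sum U W \subset singular theta {:V}.
Proof.
move=> [_ UW0 /orthovP perp]; apply/subsetP => v /imset2P[u w].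
rewrite !inE => /andP[uU /eqP theta_u] /andP[wW /eqP theta_w] ->.
apply/and3P; split=> //.
  by rewrite polar theta_u theta_w perp // addr0; apply/eqP/val_inj.
apply/eqP => uw0; have [u0 _] : u = 0 /\ w = 0.
  by apply: direct_sum_inj UW0 uU (mem0v U) wW (mem0v W) _; rewrite addr0.
by move: theta_u; rewrite u0 theta0.
Qed.

(** * The orthogonal group *)

Lemma orthogonal_group_isometry (g : {perm fV}) : g \in orthogonal_group theta ->
  [/\ forall u v : V, g (u + v) = g u + g v, forall v, theta (g v) = theta v
    & forall u v : V, phi (g u) (g v) = phi u v].
Proof.
move=> /orthogonal_setP[lin iso].
have gD (u v : V) : g (u + v) = g u + g v by have := lin 1 u v; rewrite !scale1r.
split=> // u v; have := polar (g u) (g v).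
by rewrite -gD !iso polar => /addrI.
Qed.

Lemma in_singularV (v : fV) :
  (v \in singular theta {:V}) = (theta v == 0) && (v != 0).
Proof. by rewrite inE. Qed.

Lemma orthogonal_group_acts :
  [acts orthogonal_group theta, on singular theta {:V} | 'P].
Proof.
apply/actsP => g gO v; have [gD iso _] := orthogonal_group_isometry gO.
rewrite /= apermE !in_singularV iso; congr (_ && ~~ _).
have g0 : g (0 : V) = 0 by apply: (@addrI V (g (0 : V))); rewrite -gD !addr0.
by apply/eqP/eqP => [gv0|->//]; apply: (@perm_inj _ g); rewrite gv0 g0.
Qed.

(** An orthogonal map preserves V^0 and maps the vectors orthogonal to c onto
    those orthogonal to g c; so C^g is a set of the same kind as C. *)
Lemma perp_image (B : {set fV}) (c : V) (g : {perm fV}) :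
  B \subset singular theta {:V} -> g \in orthogonal_group theta ->
  let C := [set v in singular theta {:V} | phi v c == 0] in
  B :&: [set g v | v in C] = [set v in B | phi v (g c) == 0].
Proof.
move=> /subsetP subB gO C; have [_ _ phig] := orthogonal_group_isometry gO.
apply/setP => v; rewrite !inE; case vB: (v \in B) => //=.
apply/imsetP/idP => [[x]|perp].
  by rewrite inE => /andP[_ /eqP perp] ->; rewrite phig perp.
exists (g^-1%g v); rewrite ?permKV // inE -(phig _ c) permKV perp andbT.
have := actsP orthogonal_group_acts g gO (g^-1%g v).
by rewrite /= apermE permKV => <-; exact: subB.
Qed.

(** |B| is 2^(d-2) times an odd number and |C| is odd, so |B||C| misses a
    single factor 2. *)
Lemma contradicting_value_one_sum_perp d (U W : {vspace V}) (c : V) :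
  \dim {:V} = (2 * d)%N -> nondegenerate_on phi fullv ->
  orthogonal_decomposition phi U W ->
  nondegenerate_on phi U -> nondegenerate_on phi W ->
  ~~ odd (\dim U) -> ~~ odd (\dim W) -> (4 <= \dim U)%N -> (4 <= \dim W)%N ->
  theta c = 1 ->
  contradicting_subsets (orthogonal_group theta) (singular theta {:V})
    (2 ^ (d - 1)) (value_one_sum U W)
    [set v in singular theta {:V} | phi v c == 0].
Proof.
move=> dimV ndV UW ndU ndW evenU evenW leU leW theta_c.
have [UW_V UW0 _] := UW.
have dimUW : (\dim U + \dim W = 2 * d)%N by rewrite -dimV -UW_V dimv_disjoint_sum.
have [m dimU] : exists m, \dim U = (2 * m.+2)%N by exists (\dim U)./2.-2; lia.
have [k dimW] : exists k, \dim W = (2 * k.+2)%N by exists (\dim W)./2.-2; lia.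
have d_eq : (d - 1 = m + k + 3)%N by lia.
have sing := value_one_sum_singular UW.
split=> //; first exact: orthogonal_group_acts.
- by apply/subsetP => v; rewrite inE => /andP[].
- move=> g gO; rewrite d_eq perp_image //; apply: dvdn_card_value_one_sum_perp => //.
  by have [_ -> _] := orthogonal_group_isometry gO.
have [q odd_q ->] : exists2 q, odd q & (#|value_one_sum U W| = 2 ^ (m + k + 2) * q)%N.
  have [qU oddU cardU] := card_value_one ndU dimU.
  have [qW oddW cardW] := card_value_one ndW dimW.
  exists (qU * qW)%N; first by rewrite oddM oddU.
  by rewrite card_value_one_sum // cardU cardW mulnACA -expnD; congr (2 ^ _ * _)%N; lia.
have dimV' : \dim {:V} = (2 * (m + k + 3).+1)%N by lia.
have oddC : odd #|[set v in singular theta {:V} | phi v c == 0]|.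
  rewrite -[odd _]negbK -oddS (card_singular_perp ndV dimV' theta_c).
  by rewrite oddX addnS.
rewrite d_eq [(m + k + 3)%N]addnS expnSr -mulnA dvdn_pmul2l ?expn_gt0 //.
by rewrite dvdn2 oddM odd_q oddC.
Qed.

(** * Existence of an orthogonal decomposition *)

Lemma alternating (u : V) : phi u u = 0.
Proof.
have uu : u + u = 0.
  by rewrite -mulr2n -scaler_nat (_ : 2%:R = 0 :> 'F_2) ?scale0r //; exact: val_inj.
have := polar u u; rewrite uu theta0.
by case: (F2_cases (theta u)) => ->; case: (F2_cases (phi u u)) => ->.
Qed.

(** K' is the orthogonal complement in K of a hyperbolic plane, spanned by e and
    f with phi e f = 1.  The last conclusion, that K' splits off from K, is what
    allows the step to be iterated. *)
Lemma split_hyperbolic_plane (K : {vspace V}) :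
  nondegenerate_on phi K -> (0 < \dim K)%N ->
  exists K' : {vspace V},
    [/\ nondegenerate_on phi K', \dim K = (\dim K').+2, (K' <= K)%VS
      & (K <= K' + orthov phi K')%VS].
Proof.
move=> ndK dimK; pose e := vpick K.
have eK : e \in K := memv_pick K.
have e_neq0 : e != 0 by rewrite vpick0 -dimv_eq0 -lt0n.
have eNK : e \notin orthov phi K.
  by apply: contraNN e_neq0 => /mem_orthovP/(ndK e eK)->.
have /mem_orthovPn[f fK ef] := eNK.
have {}ef : phi e f = 1 by move: ef; case: (F2_cases (phi e f)) => ->.
have fe : phi f e = 1 by rewrite skewF2C.
pose K1 := (K :&: orthov phi <[e]>)%VS; pose K' := (K1 :&: orthov phi <[f]>)%VS.
have memK' v : (v \in K') = [&& v \in K, phi v e == 0 & phi v f == 0].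
  by rewrite !memv_cap !mem_orthov1 andbA.
have eK1 : e \in K1 by rewrite memv_cap eK mem_orthov1 alternating /=.
have fNK1 : f \notin orthov phi K1.
  by apply/mem_orthovPn; exists e; rewrite ?fe.
have subK : (K <= K' + orthov phi K')%VS.
  apply/subvP => v vK; apply/memv_addP.
  (* z is the component of v in the plane spanned by e and f. *)
  pose z := phi v f *: e + phi v e *: f.
  exists (v - z); last exists z; rewrite ?subrK //; last first.
    apply/mem_orthovP => x; rewrite memK' => /and3P[_ /eqP xe /eqP xf].
    by rewrite skewF2C linearD !linearZ /= xe xf !mulr0 addr0.
  rewrite memK' memvB ?memvD ?memvZ //=.
  rewrite !(skewF2C (v - z)) !linearB !linearD !linearZ /= !alternating ef fe.
  by rewrite !mulr0 !mulr1 add0r addr0 !(skewF2C _ v) !subrr eqxx.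
exists K'; split=> //; last first.
- by rewrite /K' /K1 -capvA capvSl.
- have := eq_dim_orthov1 eNK; have := eq_dim_orthov1 fNK1; rewrite -/K1 -/K'.
  have : (0 < \dim K1)%N.
    rewrite lt0n dimv_eq0 -subv0; apply: contraNN e_neq0 => /subvP/(_ e eK1).
    by rewrite memv0.
  by lia.
move=> x xK' perp; apply: ndK => [|v /(subvP subK)/memv_addP[v' v'K' [z zK' ->]]].
  by move: xK'; rewrite memK' => /and3P[].
by rewrite formDr perp // add0r skewF2C; apply: (mem_orthovP zK').
Qed.

(** W is what remains of V after two hyperbolic planes are split off.  Taking
    for U the orthogonal complement of W, rather than the span of the two planes,
    makes its dimension and non-degeneracy consequences of V = U + W. *)
Lemma exists_orthogonal_decomposition d :
  nondegenerate_on phi fullv -> \dim {:V} = (2 * d.+4)%N ->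
  exists U W : {vspace V},
    [/\ orthogonal_decomposition phi U W,
        nondegenerate_on phi U, nondegenerate_on phi W,
        \dim U = 4%N & \dim W = (2 * d.+2)%N].
Proof.
move=> ndV dimV.
have [|K [ndK dimK _ VK]] := split_hyperbolic_plane ndV; first by rewrite dimV.
have [|W [ndW dimW WK KW]] := split_hyperbolic_plane ndK; first by lia.
have UW : (orthov phi W + W = fullv)%VS.
  apply/eqP; rewrite eqEsubv subvf /=; apply: subv_trans VK _.
  rewrite subv_add [(orthov _ _ + _)%VS]addvC KW; apply: subv_trans (addvSr _ _).
  apply/subvP => x /mem_orthovP xK; apply/mem_orthovP => w wW.
  by apply: xK; exact: (subvP WK).
have UW0 : (orthov phi W :&: W = 0)%VS.
  apply/eqP; rewrite -subv0; apply/subvP => x.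
  rewrite memv_cap memv0 => /andP[/mem_orthovP perp xW].
  by apply/eqP/(ndW x xW).
exists (orthov phi W), W; split=> //.
- move=> u uU perp; apply: ndV => [|v _]; first exact: memvf.
  have : v \in (orthov phi W + W)%VS by rewrite UW memvf.
  by case/memv_addP => x xU [w wW ->]; rewrite formDr perp // add0r (mem_orthovP uU).
- by have := dimv_disjoint_sum UW0; rewrite UW dimV; lia.
- by lia.
Qed.

End QuadraticFormCounting.

(** * Singular vectors under the orthogonal group *)

Theorem theorem4 (d : nat) (V : vectType 'F_2) (theta : V -> 'F_2)
    (phi : {skew_symmetric V}) :
  (4 <= d)%N ->
  \dim {:V} = (2 * d)%N ->
  quadratic_form theta ->
  is_psymplectic phi ->
  polarizes_to theta phi ->
  (forall (U W : {vspace V}) (c : finvect_type V),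
     orthogonal_decomposition phi U W ->
     nondegenerate_on phi U -> nondegenerate_on phi W ->
     ~~ odd (\dim U) -> ~~ odd (\dim W) ->
     (4 <= \dim U)%N -> (4 <= \dim W)%N ->
     c \in value_one theta {:V} ->
     let B := [set u + w | u in value_one theta U, w in value_one theta W] in
     let C := [set v in singular theta {:V} | phi v c == 0] in
     [/\ forall g : {perm finvect_type V}, g \in orthogonal_group theta ->
           (2 ^ (d - 1) %| #|B :&: [set g v | v in C]|)%N,
         ~~ (2 ^ (d - 1) %| #|B| * #|C|)%N
       & contradicting_subsets (orthogonal_group theta) (singular theta {:V})
           (2 ^ (d - 1)) B C]) /\
  (forall S : {set {perm finvect_type V}}, S \subset orthogonal_group theta ->
     ~ sharply_transitive S (singular theta {:V})).
Proof.
move=> d_ge4 dimV _ [/eqP rad0 _ _] polar.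
have ndV : nondegenerate_on phi fullv.
  by move=> v _ /mem_orthovP; rewrite rad0 memv0 => /eqP.
split=> [U W c UW ndU ndW evenU evenW leU leW|S SO].
  rewrite inE => /andP[_ /eqP theta_c] B C.
  have contr := contradicting_value_one_sum_perp polar dimV ndV UW ndU ndW
                  evenU evenW leU leW theta_c.
  by have [_ _ _ dvdBC ndvd] := contr; split.
have dimV' : \dim {:V} = (2 * (d - 4).+4)%N by rewrite dimV; lia.
have [U [W [UW ndU ndW dimU dimW]]] := exists_orthogonal_decomposition polar ndV dimV'.
have [q odd_q cardV1] := card_value_one polar ndV dimV'.
have /set0Pn[c] : value_one theta fullv != set0.
  by rewrite -card_gt0 cardV1 muln_gt0 expn_gt0; exact: odd_gt0.
rewrite inE => /andP[_ /eqP theta_c].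
have evenU : ~~ odd (\dim U) by rewrite dimU.
have evenW : ~~ odd (\dim W) by rewrite dimW oddM.
have leW : (4 <= \dim W)%N by rewrite dimW; lia.
have leU : (4 <= \dim U)%N by rewrite dimU.
have contr := contradicting_value_one_sum_perp polar dimV ndV UW ndU ndW
                evenU evenW leU leW theta_c.
exact: contradicting_not_sharply_transitive contr SO.
Qed.
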